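(* Suppose that the set $Y\cap\mathbb{Z}^p$ is finite. Then either problem $(P)$ is infeasible, or Algorithm 1 (described in the context) terminates after a finite number of steps at an optimal value of $(P)$, i.e. at termination (say at step $k$) the upper bound $UBD^k$ equals the optimal value of $(P)$, and this value is attained as $f(x_j,y_j)$ for some $y_j\in T^k$.
   Context: Setting. $f,g_i:\mathbb{R}^n\times\mathbb{R}^p\to\mathbb{R}$ ($i=1,\dots,m$) are continuous convex functions, $X\subseteq\mathbb{R}^n$ is a nonempty bounded polyhedral set, $Y\subseteq\mathbb{R}^p$ is a polyhedral set. Problem $(P)$ is: minimize $f(x,y)$ subject to $g_i(x,y)\le 0$ ($i=1,\dots,m$), $x\in X$, $y\in Y\cap\mathbb{Z}^p$. For fixed $y\in Y\cap\mathbb{Z}^p$, $NLP(y)$ is: minimize $f(x,y)$ over $x$ subject to $g_i(x,y)\le 0$ ($i=1,\dots,m$), $x\in X$. Let $T$ (resp. $S$) be the set of $y\in Y\cap\mathbb{Z}^p$ for which $NLP(y)$ is feasible (resp. infeasible). Standing assumption (Slater): for every $y\in T$ there is $\hat x\in X$ with $g_i(\hat x,y)<0$ for all $i=1,\dots,m$. Notation. $N(X,x)=\{\gamma\in\mathbb{R}^n:\langle\gamma,u-x\rangle\le 0\ \forall u\in X\}$ is the normal cone; $\partial f(x,y)$, $\partial g_i(x,y)$ are convex subdifferentials in the joint variable. KKT data at $(x_j,y_j)$, where $y_j\in T$ and $x_j$ solves $NLP(y_j)$: multipliers $\lambda_{j,i}\ge 0$ and vectors $(\alpha_j,\beta_j)\in\partial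 f(x_j,y_j)$, $(\xi_{j,i},\eta_{j,i})\in\partial g_i(x_j,y_j)$ ($i=1,\dots,m$) such that $\lambda_{j,i}g_i(x_j,y_j)=0$ for all $i$ and $-\alpha_j-\sum_{i=1}^m\lambda_{j,i}\xi_{j,i}\in N(X,x_j)$. Parameter $\rho_j$: let $I(x_j)=\{i:g_i(x_j,y_j)=0\}$ and $J(x_j)=\{1,\dots,m\}\setminus I(x_j)$. If $J(x_j)\neq\emptyset$, put $$\Pi_j:=\max_{i\in J(x_j)}\ \max_{(x,y)\in X\times(Y\cap\mathbb{Z}^p)}(\xi_{j,i},\eta_{j,i})^T\begin{pmatrix}x-x_j\\ y-y_j\end{pmatrix}.$$ Then $\rho_j:=\dfrac{-\max_{i\in J(x_j)}g_i(x_j,y_j)}{\Pi_j}$ if $J(x_j)\ne\emptyset$ and $\Pi_j>0$, and $\rho_j:=1$ otherwise. Feasibility problem $F(y_l)$ for $y_l\in S$: minimize $\sum_{i=1}^m u_i$ over $(x,u)\in X\times\mathbb{R}^m$ subject to $g_i(x,y_l)\le u_i$, $u_i\ge 0$ ($i=1,\dots,m$). Feasibility-problem KKT data at $(x_l,y_l)$, where $x_l$ is the $x$-component of a solution of $F(y_l)$: multipliers $\lambda_{l,i}$ with $\lambda_{l,i}=0$ if $g_i(x_l,y_l)<0$, $\lambda_{l,i}=1$ if $g_i(x_l,y_l)>0$, $\lambda_{l,i}\in[0,1]$ if $g_i(x_l,y_l)=0$, and vectors $(\xi_{l,i},\eta_{l,i})\in\partial g_i(x_l,y_l)$ ($i=1,\dots,m$)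 such that $-\sum_{i=1}^m\lambda_{l,i}\xi_{l,i}\in N(X,x_l)$. Relaxed master program $MP(T^k,S^k)$, for finite sets $T^k\subseteq T$, $S^k\subseteq S$, where for each $y_j\in T^k$ a solution $x_j$ of $NLP(y_j)$, KKT data $\lambda_{j,i},(\alpha_j,\beta_j),(\xi_{j,i},\eta_{j,i})$ ($i=1,\dots,m$) at $(x_j,y_j)$ and the resulting parameter $\rho_j$ are fixed, and for each $y_l\in S^k$ the $x$-component $x_l$ of a solution of $F(y_l)$ and feasibility-problem KKT data $\lambda_{l,i},(\xi_{l,i},\eta_{l,i})$ ($i=1,\dots,m$) at $(x_l,y_l)$ are fixed, and $UBD^k=\min\{f(x_j,y_j):y_j\in T^k\}$ ($=+\infty$ if $T^k=\emptyset$): minimize $\theta$ over $x\in X$, $y\in Y\cap\mathbb{Z}^p$, $\theta\in\mathbb{R}$ subject to $$\theta<UBD^k,$$ $$f(x_j,y_j)+(\alpha_j,\beta_j)^T\begin{pmatrix}x-x_j\\ y-y_j\end{pmatrix}\le\theta\quad\forall y_j\in T^k,$$ $$g_i(x_j,y_j)+\rho_j(\xi_{j,i},\eta_{j,i})^T\begin{pmatrix}x-x_j\\ y-y_j\end{pmatrix}\le 0\quad\forall i,\ \forall y_j\in T^k,$$ $$g_i(x_l,y_l)+(\xi_{l,i},\eta_{l,i})^T\begin{pmatrix}x-x_l\\ y-y_l\end{pmatrix}\le 0\quad\forall i,\ \forall y_l\in S^k.$$ Algorithm 1. Start with an arbitrary $y_1\in Y\cap\mathbb{Z}^p$, $T^0=S^0=\emptyset$,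 $UBD^0=+\infty$. For $k=1,2,\dots$: (i) If $y_k\in T$: let $x_k$ be an optimal solution of $NLP(y_k)$, choose KKT data at $(x_k,y_k)$ and the corresponding $\rho_k$; set $T^k=T^{k-1}\cup\{y_k\}$, $S^k=S^{k-1}$, $UBD^k=\min\{UBD^{k-1},f(x_k,y_k)\}$. (ii) If $y_k\in S$: let $x_k$ be the $x$-component of an optimal solution of $F(y_k)$, choose feasibility-problem KKT data at $(x_k,y_k)$; set $S^k=S^{k-1}\cup\{y_k\}$, $T^k=T^{k-1}$, $UBD^k=UBD^{k-1}$. (iii) If $MP(T^k,S^k)$ is infeasible, terminate. Otherwise solve $MP(T^k,S^k)$ and let $y_{k+1}$ be the $y$-component of the solution found (if $T^k=\emptyset$, where $\theta$ is unbounded below, any feasible point is taken as the solution); continue with $k+1$. *)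

(* Defs.v *)
From mathcomp Require Import all_boot all_order all_algebra.
From mathcomp Require Import all_classical all_reals all_analysis.

Set Implicit Arguments.
Unset Strict Implicit.
Unset Printing Implicit Defensive.

Import Order.TTheory GRing.Theory Num.Theory.
Import numFieldNormedType.Exports.

Local Open Scope classical_set_scope.
Local Open Scope ring_scope.

Section Generic.
Variable R : realType.

Definition dot n (u v : 'rV[R]_n) : R := \sum_(i < n) u 0 i * v 0 i.

Definition dot2 n p (s z : 'rV[R]_n * 'rV[R]_p) : R :=
  dot s.1 z.1 + dot s.2 z.2.

Definition polyhedral n (A : set 'rV[R]_n) : Prop :=
  exists (q : nat) (M : 'M[R]_(q, n)) (b : 'I_q -> R),
    A = [set x | forall i : 'I_q, dot (row i M) x <= b i].

Definition integer_points p : set 'rV[R]_p :=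
  [set y | forall i : 'I_p, y 0 i \is a Num.int].

Definition normal_cone n (A : set 'rV[R]_n) (x : 'rV[R]_n) : set 'rV[R]_n :=
  [set c | forall u, A u -> dot c (u - x) <= 0].

Definition subdifferential n p (h : 'rV[R]_n * 'rV[R]_p -> R)
    (z : 'rV[R]_n * 'rV[R]_p) : set ('rV[R]_n * 'rV[R]_p) :=
  [set s | forall w, h z + dot2 s (w - z) <= h w].

Definition is_maximum (A : set R) (v : R) : Prop := A v /\ ubound A v.

Definition is_minimizer (U : Type) (A : set U) (h : U -> R) (a : U) : Prop :=
  A a /\ forall b, A b -> h a <= h b.

End Generic.

Section OuterApproximation.
Variables (R : realType) (n p m : nat).
Variables (f : 'rV[R]_n * 'rV[R]_p -> R) (g : 'I_m -> 'rV[R]_n * 'rV[R]_p -> R).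
Variables (X : set 'rV[R]_n) (Y : set 'rV[R]_p).

Local Notation vec := ('rV[R]_n * 'rV[R]_p)%type.

Definition Yint : set 'rV[R]_p := Y `&` @integer_points R p.

Definition P_feasible : set vec :=
  [set z | [/\ X z.1, Yint z.2 & forall i, g i z <= 0]].

(* As an infimum in the extended reals, so that it is +oo when (P) is
   infeasible; attainment is stated separately. *)
Definition P_value : \bar R := ereal_inf [set (f z)%:E | z in P_feasible].

Definition NLP_feasible (y : 'rV[R]_p) : set 'rV[R]_n :=
  [set x | X x /\ forall i, g i (x, y) <= 0].

Definition NLP_solution (y : 'rV[R]_p) (x : 'rV[R]_n) : Prop :=
  is_minimizer (NLP_feasible y) (fun x' => f (x', y)) x.

Definition Tset : set 'rV[R]_p := [set y | Yint y /\ NLP_feasible y !=set0].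
Definition Sset : set 'rV[R]_p := [set y | Yint y /\ NLP_feasible y = set0].

Definition slater : Prop :=
  forall y, Tset y -> exists2 x, X x & forall i, g i (x, y) < 0.

Definition F_feasible (y : 'rV[R]_p) : set ('rV[R]_n * ('I_m -> R)) :=
  [set xu | X xu.1 /\ forall i, g i (xu.1, y) <= xu.2 i /\ 0 <= xu.2 i].

Definition F_solution (y : 'rV[R]_p) (x : 'rV[R]_n) : Prop :=
  exists u, is_minimizer (F_feasible y) (fun xu => \sum_(i < m) xu.2 i) (x, u).

Definition NLP_kkt (z : vec) (lambda : 'I_m -> R) (df : vec)
    (dg : 'I_m -> vec) : Prop :=
  [/\ forall i, 0 <= lambda i,
      subdifferential f z df,
      forall i, subdifferential (g i) z (dg i),
      forall i, lambda i * g i z = 0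
    & normal_cone X z.1 (- df.1 - \sum_(i < m) lambda i *: (dg i).1)].

Definition F_kkt (z : vec) (lambda : 'I_m -> R) (dg : 'I_m -> vec) : Prop :=
  [/\ forall i, g i z < 0 -> lambda i = 0,
      forall i, 0 < g i z -> lambda i = 1,
      forall i, g i z = 0 -> 0 <= lambda i <= 1,
      forall i, subdifferential (g i) z (dg i)
    & normal_cone X z.1 (- \sum_(i < m) lambda i *: (dg i).1)].

Definition inactive (z : vec) : set 'I_m := [set i | g i z <> 0].

(* The iterated maximum defining Pi_j, written as one maximum over the pairs
   (i, (x, y)). *)
Definition is_Pi (z : vec) (dg : 'I_m -> vec) : R -> Prop :=
  is_maximum [set v | exists i w, [/\ inactive z i, X w.1, Yint w.2
                                    & v = dot2 (dg i) (w - z)]].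

Definition is_rho (z : vec) (dg : 'I_m -> vec) (rho : R) : Prop :=
  (inactive z = set0 -> rho = 1) /\
  (inactive z !=set0 ->
     exists Pi gmax : R,
       [/\ is_Pi z dg Pi,
           is_maximum [set g i z | i in inactive z] gmax
         & rho = if 0 < Pi then - gmax / Pi else 1]).

Record nlp_data := NlpData {
  nlp_x : 'rV[R]_n;
  nlp_y : 'rV[R]_p;
  nlp_lambda : 'I_m -> R;
  nlp_df : vec;
  nlp_dg : 'I_m -> vec;
  nlp_rho : R
}.

Definition nlp_data_valid (d : nlp_data) : Prop :=
  let z := (nlp_x d, nlp_y d) in
  [/\ Tset (nlp_y d), NLP_solution (nlp_y d) (nlp_x d),
      NLP_kkt z (nlp_lambda d) (nlp_df d) (nlp_dg d)
    & is_rho z (nlp_dg d) (nlp_rho d)].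

Record feas_data := FeasData {
  feas_x : 'rV[R]_n;
  feas_y : 'rV[R]_p;
  feas_lambda : 'I_m -> R;
  feas_dg : 'I_m -> vec
}.

Definition feas_data_valid (d : feas_data) : Prop :=
  [/\ Sset (feas_y d), F_solution (feas_y d) (feas_x d)
    & F_kkt (feas_x d, feas_y d) (feas_lambda d) (feas_dg d)].

(* The sets T^k and S^k are stored together with the data fixed for each of
   their points. *)
Record state := State {
  st_T : set nlp_data;
  st_S : set feas_data;
  st_UBD : \bar R
}.

Definition MP_feasible (s : state) : set (vec * R) :=
  [set w | let: (z, theta) := w in
    [/\ X z.1 /\ Yint z.2,
        (theta%:E < st_UBD s)%E,
        forall d, st_T s d ->
          let zj := (nlp_x d, nlp_y d) in
          f zj + dot2 (nlp_df d) (z - zj) <= theta,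
        forall d, st_T s d -> forall i,
          let zj := (nlp_x d, nlp_y d) in
          g i zj + nlp_rho d * dot2 (nlp_dg d i) (z - zj) <= 0
      & forall d, st_S s d -> forall i,
          let zl := (feas_x d, feas_y d) in
          g i zl + dot2 (feas_dg d i) (z - zl) <= 0]].

Definition MP_solution (s : state) (w : vec * R) : Prop :=
  MP_feasible s w /\
  (st_T s !=set0 -> is_minimizer (MP_feasible s) snd w).

Definition initial_state : state := State set0 set0 +oo%E.

Definition update (s : state) (y : 'rV[R]_p) (s' : state) : Prop :=
  (exists d, [/\ nlp_y d = y, nlp_data_valid d
     & s' = State (st_T s `|` [set d]) (st_S s)
              (Order.min (st_UBD s) (f (nlp_x d, nlp_y d))%:E)]) \/
  (exists d, [/\ feas_y d = y, feas_data_valid d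
     & s' = State (st_T s) (st_S s `|` [set d]) (st_UBD s)]).

(* [y k] and [st k] are y_k and (T^k, S^k, UBD^k); [y 0] is not used, and
   nothing is required of [y] and [st] after the first k >= 1 at which
   MP(T^k, S^k) is infeasible, where the algorithm stops. *)
Definition algorithm_run (y : nat -> 'rV[R]_p) (st : nat -> state) : Prop :=
  [/\ Yint (y 1%N),
      st 0%N = initial_state
    & forall k, (0 < k)%N ->
        (forall j, (0 < j < k)%N -> MP_feasible (st j) !=set0) ->
        update (st k.-1) (y k) (st k) /\
        (MP_feasible (st k) !=set0 ->
           exists x theta, MP_solution (st k) ((x, y k.+1), theta))].

Definition terminates_at (st : nat -> state) (k : nat) : Prop :=
  [/\ (0 < k)%N,
      forall j, (0 < j < k)%N -> MP_feasible (st j) !=set0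
    & MP_feasible (st k) = set0].

End OuterApproximation.

(* Main.v *)
(** Only finitely many integer points are available, so the algorithm stops once
no point is visited twice.  At a point of T already visited the linearized
constraints, weighted by the KKT multipliers, force
[alpha . (x - x_j) >= 0], hence [theta >= f(x_j, y_j) >= UBD]; at a point of S
already visited they give [sum_i max(g_i(x_l, y_l), 0) <= 0], which would make
NLP(y_l) feasible.  Conversely no feasible point of (P) with value below UBD is
ever cut off: all constraints of the master program are subgradient
inequalities, except the inactive ones, which are scaled by [rho_j] precisely so
that they hold on the whole of X x (Y cap Z^p).  So UBD is a lower bound for (P)
as soon as the master program is infeasible. *)
Require Import Defs.
From mathcomp Require Import all_boot all_order all_algebra.
From mathcomp Require Import all_classical all_reals all_analysis.

Set Implicit Arguments.
Unset Strict Implicit.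
Unset Printing Implicit Defensive.

Import Order.TTheory GRing.Theory Num.Theory.
Import numFieldNormedType.Exports.

Local Open Scope classical_set_scope.
Local Open Scope ring_scope.

(** * Linearity of the dot product *)

Lemma dotDl (R : realType) n (u v w : 'rV[R]_n) :
  dot (u + v) w = dot u w + dot v w.
Proof. by rewrite /dot -big_split; apply: eq_bigr => i _; rewrite mxE mulrDl. Qed.

Lemma dotNl (R : realType) n (u w : 'rV[R]_n) : dot (- u) w = - dot u w.
Proof. by rewrite /dot -sumrN; apply: eq_bigr => i _; rewrite mxE mulNr. Qed.

Lemma dot_sumZl (R : realType) n m (a : 'I_m -> R) (u : 'I_m -> 'rV[R]_n)
    (w : 'rV[R]_n) :
  dot (\sum_(i < m) a i *: u i) w = \sum_(i < m) a i * dot (u i) w.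
Proof.
rewrite /dot; under [RHS]eq_bigr do rewrite mulr_sumr.
rewrite exchange_big; apply: eq_bigr => j _ /=.
by rewrite summxE mulr_suml; apply: eq_bigr => i _; rewrite mxE mulrA.
Qed.

Lemma dot0r (R : realType) n (u : 'rV[R]_n) : dot u 0 = 0.
Proof. by rewrite /dot big1 // => i _; rewrite mxE mulr0. Qed.

Lemma dot2_fst (R : realType) n p (s : 'rV[R]_n * 'rV[R]_p) (x x' : 'rV[R]_n)
    (y : 'rV[R]_p) :
  dot2 s ((x, y) - (x', y)) = dot s.1 (x - x').
Proof. by rewrite /dot2 /= subrr dot0r addr0. Qed.

Section Cuts.
Variables (R : realType) (n p m : nat).
Variables (f : 'rV[R]_n * 'rV[R]_p -> R) (g : 'I_m -> 'rV[R]_n * 'rV[R]_p -> R).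
Variables (X : set 'rV[R]_n) (Y : set 'rV[R]_p).

(** * Scaled cuts, and what the cuts exclude *)

Lemma rho_gt0 z dg rho :
  (forall i, g i z <= 0) -> is_rho g X Y z dg rho -> 0 < rho.
Proof.
move=> gz_le0 [rho1 rhoE]; have [/rho1 -> //|/set0P/rhoE] := eqVneq (inactive g z) set0.
(* [gmax] is attained at an inactive index, where [g i z] is at most 0 and nonzero, so the numerator
   [- gmax] is positive. *)
move=> [Pi [gmax [_ [[i gi_neq0 <-] _] ->]]]; case: ifP => // Pi_gt0.
by rewrite divr_gt0 // oppr_gt0 lt_neqAle gz_le0 andbT; apply/eqP.
Qed.

(** For active [i], positive scaling preserves the sign in the subgradient inequality. For inactive
    [i] with [0 < Pi], the left side is at most [gmax + rho * Pi = 0]; otherwise [rho = 1] and the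
    cut is the subgradient inequality itself. *)
Lemma rho_cut_valid z dg rho w i :
  (forall i, g i z <= 0) -> subdifferential (g i) z (dg i) ->
  is_rho g X Y z dg rho -> X w.1 -> Yint Y w.2 -> g i w <= 0 ->
  g i z + rho * dot2 (dg i) (w - z) <= 0.
Proof.
move=> gz_le0 sub_gi rhoP Xw Yw giw; have rho0 := rho_gt0 gz_le0 rhoP.
have := le_trans (sub_gi w) giw.
have [giz0|giz] := eqVneq (g i z) 0; first by rewrite giz0 !add0r pmulr_rle0.
have inact_i : inactive g z i by apply/eqP.
have [|Pi [gmax [[_ Pi_ub] [_ gmax_ub] rhoE]]] := rhoP.2; first by exists i.
have gi_le : g i z <= gmax by apply: gmax_ub; exists i.
have dot_le : dot2 (dg i) (w - z) <= Pi by apply: Pi_ub; exists i, w.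
move: rho0; rewrite rhoE; case: ifP => [Pi_gt0 rho0 _|_ _]; last by rewrite mul1r.
apply: le_trans (lerD gi_le (ler_wpM2l (ltW rho0) dot_le)) _.
by rewrite divfK ?gt_eqF // subrr.
Qed.

Lemma nlp_data_P_feasible d :
  nlp_data_valid f g X Y d -> P_feasible g X Y (nlp_x d, nlp_y d).
Proof. by case=> -[Yd _] [[Xd gd] _] _ _; split. Qed.

Lemma nlp_cuts_optimal d x theta :
  nlp_data_valid f g X Y d -> X x ->
  f (nlp_x d, nlp_y d)
    + dot2 (nlp_df d) ((x, nlp_y d) - (nlp_x d, nlp_y d)) <= theta ->
  (forall i, g i (nlp_x d, nlp_y d)
    + nlp_rho d * dot2 (nlp_dg d i) ((x, nlp_y d) - (nlp_x d, nlp_y d)) <= 0) ->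
  f (nlp_x d, nlp_y d) <= theta.
Proof.
move=> dv Xx; have [_ _ gd] := nlp_data_P_feasible dv.
case: dv => _ _ [l_ge0 _ _ lg0 kkt] rhoP; have rho0 := rho_gt0 gd rhoP.
rewrite dot2_fst => f_cut g_cut; apply: le_trans f_cut; rewrite lerDl.
have := kkt _ Xx; rewrite /= dotDl !dotNl dot_sumZl -opprD oppr_le0.
(* It remains to see that each weighted term is nonpositive: by complementarity either the
   multiplier vanishes, or the constraint is active and its cut, divided by [rho], bounds the dot
   product by 0. *)
move=> /le_trans -> //; rewrite gerDl; apply: sumr_le0 => i _.
have /eqP := lg0 i; rewrite mulf_eq0 => /orP[/eqP ->|/eqP gi0].
  by rewrite mul0r.
by have := g_cut i; rewrite gi0 add0r dot2_fst pmulr_rle0 //; apply: mulr_ge0_le0.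
Qed.

Lemma feas_cuts_exclude d x :
  feas_data_valid g X Y d -> X x ->
  ~ (forall i, g i (feas_x d, feas_y d)
    + dot2 (feas_dg d i) ((x, feas_y d) - (feas_x d, feas_y d)) <= 0).
Proof.
move=> [[_ infeas] [u [[/= Xd _] _]] [l0 l1 l01 _ kkt]] Xx cut.
pose z := (feas_x d, feas_y d).
(* The product is the positive part of [g i z], whichever multiplier is chosen when [g i z = 0]. *)
have lP i : 0 <= feas_lambda d i /\ 0 <= feas_lambda d i * g i z.
  have [gi|gi|gi] := ltgtP (g i z) 0.
  - by rewrite l0 // mul0r.
  - by rewrite l1 // mul1r ler01 ltW.
  - by rewrite gi mulr0; have /andP[] := l01 i gi.
have sum_le0 : \sum_(i < m) feas_lambda d i * g i z <= 0.
  have := kkt _ Xx; rewrite /= dotNl dot_sumZl oppr_le0 => kkt_ge0.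
  apply: (@le_trans _ _ (\sum_(i < m) feas_lambda d i * g i z
      + \sum_(i < m) feas_lambda d i * dot (feas_dg d i).1 (x - feas_x d))).
    by rewrite lerDl.
  rewrite -big_split; apply: sumr_le0 => i _ /=; rewrite -mulrDr.
  by apply: mulr_ge0_le0; [exact: (lP i).1|rewrite -(dot2_fst _ _ _ (feas_y d))].
suff : NLP_feasible g X (feas_y d) (feas_x d) by rewrite infeas.
split=> // i; rewrite leNgt; apply/negP => gi_gt0.
have : 0 < \sum_(i < m) feas_lambda d i * g i z.
  rewrite (bigD1 i) //= (l1 i gi_gt0) mul1r ltr_pwDl //.
  by apply: sumr_ge0 => j _; exact: (lP j).2.
by rewrite ltNge sum_le0.
Qed.

(** * The loop invariant and its consequences for the master program *)

Definition visited (s : state R n p m) (y : 'rV[R]_p) : Prop :=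
  (exists2 d, st_T s d & nlp_y d = y) \/ (exists2 d, st_S s d & feas_y d = y).

Definition consistent (s : state R n p m) : Prop :=
  [/\ forall d, st_T s d -> nlp_data_valid f g X Y d,
      forall d, st_S s d -> feas_data_valid g X Y d,
      forall d, st_T s d -> (st_UBD s <= (f (nlp_x d, nlp_y d))%:E)%E
    & st_UBD s = +oo%E \/
      exists2 d, st_T s d & st_UBD s = (f (nlp_x d, nlp_y d))%:E].

Lemma consistent_initial : consistent (initial_state R n p m).
Proof. by split=> //; left. Qed.

Lemma consistent_update s y s' :
  consistent s -> update f g X Y s y s' -> consistent s'.
Proof.
move=> [Tv Sv Tub ubd] [] [d [_ dv ->]]; split=> //=.
- by move=> e [/Tv//|->].
- by move=> e [/Tub e_ub|->]; rewrite ge_min ?e_ub ?lexx ?orbT.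
- right; have [le_ubd|_] := leP (st_UBD s) (f (nlp_x d, nlp_y d))%:E.
    (* The minimum cannot keep [+oo], because the new value is finite. *)
    case: ubd le_ubd => [->|[e Te ->] _]; first by rewrite leye_eq.
    by exists e => //; left.
  by exists d => //; right.
- by move=> e [/Sv//|->].
Qed.

Lemma update_visited s y s' : update f g X Y s y s' -> visited s' y.
Proof.
by move=> [] [d [dy _ ->]]; [left|right]; exists d => //; right.
Qed.

Lemma visited_update s y s' y' :
  update f g X Y s y s' -> visited s y' -> visited s' y'.
Proof.
move=> [] [d [_ _ ->]] [] [e es ey]; [left|right|left|right];
  by exists e => //=; left.
Qed.

Lemma update_Yint s y s' : update f g X Y s y s' -> Yint Y y.
Proof. by case=> -[d [<- [[]]]]. Qed.

Lemma MP_not_visited s x y theta :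
  consistent s -> MP_feasible f g X Y s ((x, y), theta) -> ~ visited s y.
Proof.
move=> [Tv Sv Tub _] [[/= Xx _] lt_ubd f_cut T_cut S_cut] [] [d ds dy]; subst y.
  have := nlp_cuts_optimal (Tv _ ds) Xx (f_cut _ ds) (T_cut _ ds).
  by apply/negP; rewrite -ltNge -lte_fin (lt_le_trans lt_ubd) ?Tub.
exact: feas_cuts_exclude (Sv _ ds) Xx (S_cut _ ds).
Qed.

(** With [theta := f z], the objective cuts become subgradient inequalities for [f]. *)
Lemma P_feasible_MP s z :
  consistent s -> P_feasible g X Y z -> ((f z)%:E < st_UBD s)%E ->
  MP_feasible f g X Y s (z, f z).
Proof.
move=> [Tv Sv _ _] [Xz Yz gz] lt_ubd; split=> //.
- by move=> d /Tv[_ _ [_ sub_f _ _ _] _]; exact: sub_f.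
- move=> d /Tv dv i /=; have [_ _ gd] := nlp_data_P_feasible dv.
  by case: dv => _ _ [_ _ sub_g _ _] rhoP; apply: rho_cut_valid rhoP _ _ _.
- by move=> d /Sv[_ _ [_ _ _ sub_g _]] i /=; exact: le_trans (sub_g i z) (gz i).
Qed.

Lemma MP_infeasible_optimal s :
  consistent s -> P_feasible g X Y !=set0 -> MP_feasible f g X Y s = set0 ->
  st_UBD s = P_value f g X Y /\
  exists2 d, st_T s d & P_feasible g X Y (nlp_x d, nlp_y d) /\
    st_UBD s = (f (nlp_x d, nlp_y d))%:E.
Proof.
move=> sc [z0 z0P] infeas.
have ubd_le z : P_feasible g X Y z -> (st_UBD s <= (f z)%:E)%E.
  move=> zP; rewrite leNgt; apply/negP => /(P_feasible_MP sc zP).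
  by rewrite infeas.
have [Tv _ _ [ubdy|[d Td ubdE]]] := sc.
  (* An infinite bound would exceed the finite value [f z0]. *)
  by have := ubd_le _ z0P; rewrite ubdy leye_eq.
have dP := nlp_data_P_feasible (Tv _ Td).
split; last by exists d.
apply/eqP; rewrite eq_le; apply/andP; split.
  by apply: le_ereal_inf_tmp => _ [z zP <-]; exact: ubd_le.
by rewrite ubdE; apply: ereal_inf_lbound; exists (nlp_x d, nlp_y d).
Qed.

(** * Runs of the algorithm *)

Lemma run_invariant (y : nat -> 'rV[R]_p) (st : nat -> state R n p m) k :
  algorithm_run f g X Y y st ->
  (forall j, (0 < j < k)%N -> MP_feasible f g X Y (st j) !=set0) ->
  consistent (st k) /\
  forall j, (0 < j <= k)%N -> visited (st k) (y j) /\ Yint Y (y j).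
Proof.
move=> [_ st0 step]; elim: k => [_|k IH feas].
  by rewrite st0; split=> [|[|j]//]; exact: consistent_initial.
have [|sc vis] := IH.
  by move=> j /andP[j0 jk]; apply: feas; rewrite j0 ltnW.
(* Only the master programs before step [k.+1] must be feasible, so the invariant also covers the
   terminating step. *)
have [upd _] := step k.+1 isT feas.
split=> [|j]; first exact: consistent_update sc upd.
case/andP=> j0; rewrite leq_eqVlt => /orP[/eqP ->|jk].
  by split; [exact: update_visited upd|exact: update_Yint upd].
have [|vj Yj] := vis j; first by rewrite j0.
by split=> //; exact: visited_update upd vj.
Qed.

Lemma run_terminates (y : nat -> 'rV[R]_p) (st : nat -> state R n p m) :
  finite_set (Yint Y) -> algorithm_run f g X Y y st ->
  exists k, terminates_at f g X Y st k.
Proof.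
move=> Yfin run.
have [[k k0 infeas]|all_feas] :=
    pselect (exists2 k, (0 < k)%N & MP_feasible f g X Y (st k) = set0).
  have ex_k : exists k, (0 < k)%N && `[< MP_feasible f g X Y (st k) = set0 >].
    by exists k; rewrite k0; apply/asboolP.
  (* The least such index is taken, since the earlier master programs must be feasible. *)
  case: (ex_minnP ex_k) => j /andP[j0 /asboolP infeas_j] j_min.
  exists j; split=> // i /andP[i0 ij]; apply/set0P/eqP => infeas_i.
  by have := j_min i; rewrite i0 asboolT // leqNgt ij => /(_ isT).
have feas j : (0 < j)%N -> MP_feasible f g X Y (st j) !=set0.
  by move=> j0; apply/set0P/eqP => infeas; apply: all_feas; exists j.
have inv k := run_invariant run (fun j (jk : (0 < j < k)%N) => feas j (andP jk).1).
(* For [j = k.+1], [y j] comes from the master program at [st k], where [y i] is already visited. *)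
have fresh i j : (0 < i < j)%N -> y i <> y j.
  case: j => [|k]; first by rewrite ltn0 andbF.
  rewrite ltnS => /andP[i0 ik] yij.
  have k0 : (0 < k)%N := leq_trans i0 ik.
  have [_ _ /(_ k k0)[j /andP[j0 _]|]] := run; first exact: feas.
  move=> _ /(_ (feas k k0))[x [theta [MPk _]]].
  apply: (MP_not_visited (inv k).1 MPk); rewrite -yij.
  by have [] := (inv k).2 i; rewrite ?i0.
exfalso; apply: infinite_nat.
(* The shift skips the unconstrained [y 0]; the remaining iterates would inject [nat] into a finite
   set. *)
rewrite (_ : setT = (fun k => y k.+1) @^-1` Yint Y).
  apply: finite_preimage => // i j _ _ yij; apply/eqP.
  by case: ltngtP => // [ij|ji]; [have := fresh i.+1 j.+1|have := fresh j.+1 i.+1];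
    rewrite /= ltnS => /(_ _) []//.
by apply/seteqP; split=> // k _ /=; have [] := (inv k.+1).2 k.+1; rewrite ?leqnn.
Qed.

End Cuts.

Theorem theorem3p3 (R : realType) (n p m : nat)
    (f : 'rV[R]_n * 'rV[R]_p -> R)
    (g : 'I_m -> 'rV[R]_n * 'rV[R]_p -> R)
    (X : set 'rV[R]_n) (Y : set 'rV[R]_p)
    (f_continuous : continuous f)
    (f_convex : @convex_function R ('rV[R]_n * 'rV[R]_p)%type setT f)
    (g_continuous : forall i, continuous (g i))
    (g_convex :
       forall i, @convex_function R ('rV[R]_n * 'rV[R]_p)%type setT (g i))
    (X_nonempty : X !=set0) (X_bounded : bounded_set X)
    (X_polyhedral : polyhedral X) (Y_polyhedral : polyhedral Y)
    (slater_condition : slater g X Y)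
    (Yint_finite : finite_set (Yint Y)) :
  P_feasible g X Y = set0 \/
  forall (y : nat -> 'rV[R]_p) (st : nat -> state R n p m),
    algorithm_run f g X Y y st ->
    exists k,
      [/\ terminates_at f g X Y st k,
          st_UBD (st k) = P_value f g X Y
        & exists2 d, st_T (st k) d &
            P_feasible g X Y (nlp_x d, nlp_y d) /\
            st_UBD (st k) = (f (nlp_x d, nlp_y d))%:E].
Proof.
have [|/set0P Pfeas] := eqVneq (P_feasible g X Y) set0; [by left|right].
move=> y st run; have [k kterm] := run_terminates Yint_finite run.
have [k0 feas infeas] := kterm.
have [sc _] := run_invariant run feas.
by have [ubdE att] := MP_infeasible_optimal sc Pfeas infeas; exists k.
Qed.
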